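(* As $d\to\infty$, $$\mathbb{P}(V_\infty=0)=1-\left(\tfrac d2+1\right)2^{-d}+O(d^32^{-2d}),$$ $$\mathbb{P}(V_\infty=-2)=2^{-d}+O(d^3 2^{-2d}),$$ $$\mathbb{P}(V_\infty=2)=\tfrac d2\,2^{-d}+O(d^32^{-2d}),$$ $$\mathbb{E}V_\infty=(d-2)2^{-d}+O(d^32^{-2d}).$$ Here $O(d^32^{-2d})$ denotes a quantity (of either sign) whose absolute value is at most $Cd^32^{-2d}$ for all sufficiently large $d$, with $C$ an absolute constant.
   Context: On the infinite rooted $d$-ary tree $\mathbb{T}_d$ (every vertex has exactly $d$ children) with root $\rho$, put i.i.d. cookies $X_e$ uniform on $\{-1,+1\}$ on the edges. For $n\ge0$ set $V_n(v)=0$ for vertices $v$ at height (distance from $\rho$) $2n$, and for vertices of height less than $2n$ set recursively $V_n(v)=\max_u\{X_{uv}+V_n(u)\}$ if $v$ has even height and $V_n(v)=\min_u\{X_{uv}+V_n(u)\}$ if $v$ has odd height, where $u$ ranges over the children of $v$. Let $V_n:=V_n(\rho)$, the value of the $n$-round game. For $d\ge15$, $V_n$ converges almost surely as $n\to\infty$, and $V_\infty$ (which depends on $d$) denotes the limit. *)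

(* Defs.v *)
From HB Require Import structures.
From mathcomp Require Import all_boot all_order all_algebra.
From mathcomp Require Import all_classical all_reals all_analysis.
Set Implicit Arguments.
Unset Strict Implicit.
Unset Printing Implicit Defensive.
Import Order.TTheory GRing.Theory Num.Theory.
Import numFieldNormedType.Exports.

Local Open Scope classical_set_scope.
Local Open Scope ring_scope.

(* A vertex of the infinite rooted d-ary tree is the finite word of child
   indices read along the path from the root [::]; its height is its size and
   its children are the [rcons v i].  The edge from v to [rcons v i] is the
   pair (v, i), so that edges are in bijection with [edge d]. *)
Definition vertex (d : nat) : Type := seq 'I_d.
Definition edge (d : nat) : Type := (vertex d * 'I_d)%type.

(* Maximum and minimum of a nonempty list; starting the iteration from the head
   of the list makes the default value 0 matter only for the empty list. *)
Definition seq_max (R : realType) (s : seq R) : R :=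
  \big[Num.max/head 0 s]_(x <- s) x.
Definition seq_min (R : realType) (s : seq R) : R :=
  \big[Num.min/head 0 s]_(x <- s) x.

Section Game.
Variables (R : realType) (d : nat) (x : edge d -> R).

(* [k] is the number of moves still to be played from [v]. *)
Fixpoint game_rec (k : nat) (v : vertex d) : R :=
  if k is k'.+1 then
    let s := [seq x (v, i) + game_rec k' (rcons v i) | i <- enum 'I_d] in
    if odd (size v) then seq_min s else seq_max s
  else 0.

(* The value at [v] of the n-round game with cookies [x]; meaningful for
   vertices of height at most 2n, as the three lemmas below show. *)
Definition game_value (n : nat) (v : vertex d) : R :=
  game_rec (2 * n - size v) v.

Lemma game_value_leaf (n : nat) (v : vertex d) :
  size v = (2 * n)%N -> game_value n v = 0.
Proof. by rewrite /game_value => ->; rewrite subnn. Qed.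

Lemma game_value_even (n : nat) (v : vertex d) :
  (size v < 2 * n)%N -> ~~ odd (size v) ->
  game_value n v =
    seq_max [seq x (v, i) + game_value n (rcons v i) | i <- enum 'I_d].
Proof.
move=> vn /negbTE ev; rewrite /game_value -(prednK (n := (_ - _)%N)) ?subn_gt0//=.
by rewrite ev; congr seq_max; apply: eq_map => i; rewrite size_rcons -subnS.
Qed.

Lemma game_value_odd (n : nat) (v : vertex d) :
  (size v < 2 * n)%N -> odd (size v) ->
  game_value n v =
    seq_min [seq x (v, i) + game_value n (rcons v i) | i <- enum 'I_d].
Proof.
move=> vn ov; rewrite /game_value -(prednK (n := (_ - _)%N)) ?subn_gt0//=.
by rewrite ov; congr seq_min; apply: eq_map => i; rewrite size_rcons -subnS.
Qed.

End Game.

Section Cookies.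
Context (disp : measure_display) (T : measurableType disp) (R : realType).
Variable P : probability T R.

Definition mutually_independent (I : eqType) (X : I -> {RV P >-> R}) : Prop :=
  forall (J : seq I) (A : I -> set R), uniq J ->
    (forall i, measurable (A i)) ->
    P (\bigcap_(i in [set` J]) (X i @^-1` A i)) =
    (\prod_(i <- J) P (X i @^-1` A i))%E.

Definition uniform_sign (X : {RV P >-> R}) : Prop :=
  P (X @^-1` [set 1]) = (2^-1)%:E /\ P (X @^-1` [set -1]) = (2^-1)%:E.

Definition iid_cookies (d : nat) (X : edge d -> {RV P >-> R}) : Prop :=
  mutually_independent X /\ forall e, uniform_sign (X e).

(* The value of the n-round game, as a function of the outcome. *)
Definition round_value (d : nat) (X : edge d -> {RV P >-> R}) (n : nat) (w : T)
  : R := game_value (fun e => X e w) n [::].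

End Cookies.

(* Main.v *)
(** Let [a_n t = P (V_n >= t)].  Conditioning on the first two levels of the tree,
    whose subtrees are independent, gives
      [a_(n+1) t = 1 - (1 - (((a_n (t-2) + a_n t)/2)^d + ((a_n t + a_n (t+2))/2)^d)/2)^d]
    with [a_0] the indicator of [t <= 0].  Write [e = 2^-d].  For large [d] the bounds
    [a_n 2 <= d e] and [1 - a_n 0 <= 2 e] are preserved by the recursion, and fed back
    into it once they yield [a_n 2 = d e / 2 + O(d^3 e^2)] and [1 - a_n 0 = e + O(d^3 e^2)]
    for [n >= 1].  Further out each step of 2 in [t] costs another factor [e], since
    [a_(n+1) (t+2) <= d (a_n t)^d] and [1 - a_(n+1) t <= (d (1 - a_n (t+2)))^d].
    The values are even integers, so almost sure convergence means that [V_n] is eventually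
    constant; hence the law of [V_n] converges to that of the limit, with all these bounds. *)
Require Import Defs.
From HB Require Import structures.
From mathcomp Require Import all_boot all_order all_algebra.
From mathcomp Require Import all_classical all_reals all_analysis.
From mathcomp Require Import measurable_realfun ring lra zify.
Set Implicit Arguments.
Unset Strict Implicit.
Unset Printing Implicit Defensive.
Import Order.TTheory GRing.Theory Num.Theory.
Import numFieldNormedType.Exports.

Local Open Scope classical_set_scope.
Local Open Scope ring_scope.

(** * Comparison and membership for maxima and minima of lists *)

Lemma le_seq_max (R : realType) (t : R) (s : seq R) : s != [::] ->
  (t <= seq_max s) = has (fun x => t <= x) s.
Proof.
case: s => // x s _; rewrite /seq_max [head _ _]/=.
(* The head is both the start of the fold and an entry of the list; separating the two roles allows
   the induction, and idempotence merges them again. *)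
suff -> : (t <= \big[Num.max/x]_(y <- x :: s) y) =
    (t <= x) || has (fun y => t <= y) (x :: s).
  by rewrite /= orbA orbb.
elim: (x :: s) => [|y r IH]; first by rewrite big_nil orbF.
by rewrite big_cons le_max IH /= orbCA.
Qed.

Lemma le_seq_min (R : realType) (t : R) (s : seq R) : s != [::] ->
  (t <= seq_min s) = all (fun x => t <= x) s.
Proof.
case: s => // x s _; rewrite /seq_min [head _ _]/=.
suff -> : (t <= \big[Num.min/x]_(y <- x :: s) y) =
    (t <= x) && all (fun y => t <= y) (x :: s).
  by rewrite /= andbA andbb.
elim: (x :: s) => [|y r IH]; first by rewrite big_nil andbT.
by rewrite big_cons le_min IH /= andbCA.
Qed.

Lemma seq_max_mem (R : realType) (s : seq R) : s != [::] -> seq_max s \in s.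
Proof.
case: s => // x s _; rewrite /seq_max [head _ _]/=.
have H r : \big[Num.max/x]_(y <- r) y \in x :: r.
  elim: r => [|y r]; first by rewrite big_nil mem_head.
  rewrite big_cons maxEle !inE orbCA => IH.
  by case: ifP => _; rewrite ?eqxx ?IH ?orbT.
by have := H (x :: s); rewrite inE => /orP[/eqP {1}->|//]; rewrite mem_head.
Qed.

Lemma seq_min_mem (R : realType) (s : seq R) : s != [::] -> seq_min s \in s.
Proof.
case: s => // x s _; rewrite /seq_min [head _ _]/=.
have H r : \big[Num.min/x]_(y <- r) y \in x :: r.
  elim: r => [|y r]; first by rewrite big_nil mem_head.
  rewrite big_cons minEle !inE orbCA => IH.
  by case: ifP => _; rewrite ?eqxx ?IH ?orbT.
by have := H (x :: s); rewrite inE => /orP[/eqP {1}->|//]; rewrite mem_head.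
Qed.

(** * Cookie configurations of finite depth under the uniform law *)

(* The cookies on the first [k] levels of the tree: for each child of the root,
   the sign of the cookie leading to it ([true] for -1) and the cookies below. *)
Fixpoint conf (d k : nat) : finType :=
  if k is k'.+1 then {ffun 'I_d -> bool * conf d k'} : finType else unit.

(* The bit is the parity of the height of the root: [true] when the minimizer
   is to move. *)
Fixpoint conf_val (R : realType) (d k : nat) : bool -> conf d k -> R :=
  match k return bool -> conf d k -> R with
  | 0 => fun _ _ => 0
  | k'.+1 => fun o (c : {ffun 'I_d -> bool * conf d k'}) =>
    let s := [seq (-1) ^+ (c i).1 + conf_val R (~~ o) (c i).2
             | i <- enum 'I_d] in
    if o then seq_min s else seq_max s
  end.

(** Probability under the uniform law on [T]; counting replaces measure theory until the law of
    [V_n] is needed. *)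
Definition freq (R : realType) (T : finType) (p : pred T) : R :=
  #|p|%:R / #|T|%:R.

Lemma freqC (R : realType) (T : finType) (p : pred T) : (0 < #|T|)%N ->
  freq R (predC p) = 1 - freq R p.
Proof.
move=> T0; rewrite /freq -(cardC p) natrD -[predC _]/(predC p).
have : (#|p| + #|predC p|)%:R != 0 :> R by rewrite cardC pnatr_eq0 -lt0n.
by rewrite natrD => h; field.
Qed.

Lemma freq_eq (R : realType) (T : finType) (p q : pred T) : p =1 q ->
  freq R p = freq R q.
Proof. by move=> pq; rewrite /freq (eq_card (pq : p =i q)). Qed.

Lemma freq_le (R : realType) (T : finType) (p q : pred T) :
  (forall x, p x -> q x) -> freq R p <= freq R q.
Proof.
move=> pq; rewrite /freq ler_wpM2r ?invr_ge0 ?ler0n// ler_nat.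
by apply: subset_leq_card; apply/fintype.subsetP => x; exact: pq.
Qed.

(** The first coordinate is a fair sign independent of the second, so conditioning on it averages
    two frequencies. *)
Lemma freq_bool (R : realType) (T : finType) (p : pred (bool * T)) :
  freq R p =
    (freq R (fun x => p (false, x)) + freq R (fun x => p (true, x))) / 2.
Proof.
have E : #|p| = (#|(fun x => p (false, x)) : pred T|
                 + #|(fun x => p (true, x)) : pred T|)%N.
  rewrite -!sum1_card big_mkcond /= [RHS]addnC.
  rewrite (big_mkcond (fun x => x \in _)) /=.
  rewrite [X in _ = (_ + X)%N](big_mkcond (fun x => x \in _)) /=.
  rewrite (eq_bigr (fun i : bool * T => if p (i.1, i.2) then 1%N else 0%N));
    last by case.
  rewrite -(pair_bigA _ (fun b x => if p (b, x) then 1%N else 0%N)) /=.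
  by rewrite big_bool.
rewrite /freq E card_prod card_bool natrM natrD invfM.
rewrite [X in _ * X]mulrC mulrA.
by rewrite mulrDl.
Qed.

(** Independence of the [d] subtrees: a coordinatewise condition cuts out a product set. *)
Lemma freq_ffun (R : realType) (d : nat) (T : finType) (p : pred T) :
  freq R (fun f : {ffun 'I_d -> T} => [forall i, p (f i)]) = freq R p ^+ d.
Proof.
rewrite /freq card_ffun card_ord natrX expr_div_n; congr (_ / _).
rewrite -natrX; congr _%:R.
by rewrite -[in RHS](card_ord d) -card_ffun_on; apply: eq_card.
Qed.

Lemma card_conf (d k : nat) : (0 < #|conf d k|)%N.
Proof.
elim: k => [|k IH] /=; first by rewrite card_unit.
by rewrite card_ffun expn_gt0 card_prod card_bool muln_gt0 IH.
Qed.

(** * Recursion for the tails of the finite game, and parity of its values *)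

Section ConfTail.
Context (R : realType) (d : nat).
Hypothesis d0 : (0 < d)%N.

Definition conf_tail (k : nat) (o : bool) (t : R) : R :=
  freq R (fun c : conf d k => t <= conf_val R o c).

Lemma map_enum_neq0 (T : eqType) (f : 'I_d -> T) :
  [seq f i | i <- enum 'I_d] != [::].
Proof. by rewrite -size_eq0 size_map size_enum_ord -lt0n. Qed.

Lemma conf_tail_cookie (k : nat) (o : bool) (t : R) :
  freq R (fun y : bool * conf d k => t <= (-1) ^+ y.1 + conf_val R o y.2) =
  (conf_tail k o (t - 1) + conf_tail k o (t + 1)) / 2.
Proof.
rewrite freq_bool; congr ((_ + _) / 2); apply: freq_eq => c /=.
  by rewrite expr0 lerBlDl.
by rewrite expr1 addrC lerBrDr.
Qed.

Lemma conf_tail_min (k : nat) (t : R) : conf_tail k.+1 true t =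
  ((conf_tail k false (t - 1) + conf_tail k false (t + 1)) / 2) ^+ d.
Proof.
rewrite -conf_tail_cookie -freq_ffun; apply: freq_eq => c /=.
rewrite le_seq_min ?map_enum_neq0// all_map.
apply/allP/forallP => [h i|h i _]; last exact: h.
by apply: h; rewrite mem_enum.
Qed.

(** A maximum falls below [t] exactly when all [d] options do, so the product formula is applied to
    the complementary event. *)
Lemma conf_tail_max (k : nat) (t : R) : conf_tail k.+1 false t =
  1 - (1 - (conf_tail k true (t - 1) + conf_tail k true (t + 1)) / 2) ^+ d.
Proof.
rewrite -conf_tail_cookie -freqC; last first.
  by rewrite card_prod card_bool muln_gt0 card_conf.
rewrite -freq_ffun -freqC; last exact: (card_conf d k.+1).
apply: freq_eq => c /=.
rewrite le_seq_max ?map_enum_neq0// has_map negb_forall.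
apply/hasP/existsP => [[i _ h]|[i h]]; exists i; rewrite ?negbK// ?mem_enum//.
by move: h; rewrite negbK.
Qed.

Lemma conf_tail0 (o : bool) (t : R) : conf_tail 0 o t = (t <= 0)%R%:R.
Proof.
rewrite /conf_tail /freq /= card_unit divr1; congr _%:R.
case: (t <= 0)%R; first by rewrite -[RHS]/1%N -[RHS]card_unit; apply: eq_card.
by apply: eq_card0.
Qed.

Lemma conf_tail_ge0 (k : nat) (o : bool) (t : R) : 0 <= conf_tail k o t.
Proof. by rewrite divr_ge0. Qed.

Lemma conf_tail_le1 (k : nat) (o : bool) (t : R) : conf_tail k o t <= 1.
Proof.
by rewrite ler_pdivrMr ?ltr0n ?card_conf// mul1r ler_nat max_card.
Qed.

Lemma conf_tail_nincr (k : nat) (o : bool) (s t : R) :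
  s <= t -> conf_tail k o t <= conf_tail k o s.
Proof. by move=> st; apply: freq_le => c; exact: le_trans. Qed.

Definition round_tail (n : nat) (t : R) : R := conf_tail (2 * n) false t.

Lemma round_tailS (n : nat) (t : R) : round_tail n.+1 t =
  1 - (1 - (((round_tail n (t - 2) + round_tail n t) / 2) ^+ d +
            ((round_tail n t + round_tail n (t + 2)) / 2) ^+ d) / 2) ^+ d.
Proof.
rewrite /round_tail mulnS conf_tail_max !conf_tail_min.
by rewrite subrK addrK -addrA -opprD -addrA.
Qed.

(** Each cookie is odd, so every move flips the parity; after [2 * n] moves the value is even. *)
Lemma conf_val_int (k : nat) (o : bool) (c : conf d k) :
  exists z : int, conf_val R o c = (odd k)%:R + 2 * z%:~R.
Proof.
elim: k o c => [|k IH] o c /=; first by exists 0; rewrite mulr0 addr0.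
set s := map _ _.
have : (if o then seq_min s else seq_max s) \in s.
  have : s != [::] by exact: map_enum_neq0.
  by case: (o) => s0; [exact: seq_min_mem|exact: seq_max_mem].
move=> /mapP[i _ ->]; have [z ->] := IH (~~ o) (c i).2.
(* Comes from [(-1) ^+ b = 1 - 2 * b] and from [odd k.+1] being [1 - odd k] as a number. *)
exists (z + (odd k : nat)%:Z - ((c i).1 : nat)%:Z).
rewrite rmorphB rmorphD /= -!pmulrn.
by case: (odd k); case: (c i).1; rewrite ?expr0 ?expr1 /=; ring.
Qed.

End ConfTail.

(** * Elementary power inequalities *)

Lemma bernoulli_ge (R : realType) (x : R) (n : nat) : 0 <= x <= 1 ->
  1 - n%:R * x <= (1 - x) ^+ n.
Proof.
move=> /andP[x0 x1]; elim: n => [|n IH]; first by rewrite expr0 mul0r subr0.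
rewrite exprSr; have n0 : 0 <= n%:R :> R by [].
apply: (@le_trans _ _ ((1 - n%:R * x) * (1 - x))).
  rewrite -natr1; nra.
by apply: ler_wpM2r => //; rewrite subr_ge0.
Qed.

Lemma bernoulli_le (R : realType) (x : R) (n : nat) : 0 <= x <= 1 ->
  (1 - x) ^+ n <= 1 - n%:R * x + (n%:R * x) ^+ 2.
Proof.
move=> /andP[x0 x1]; elim: n => [|n IH].
  by rewrite expr0 mul0r subr0 expr0n addr0.
rewrite exprSr; have n0 : 0 <= n%:R :> R by [].
apply: (@le_trans _ _ ((1 - n%:R * x + (n%:R * x) ^+ 2) * (1 - x))).
  by apply: ler_wpM2r => //; rewrite subr_ge0.
rewrite -natr1 -subr_ge0.
have -> : 1 - (n%:R + 1) * x + ((n%:R + 1) * x) ^+ 2 -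
    (1 - n%:R * x + (n%:R * x) ^+ 2) * (1 - x) =
    x ^+ 2 * (n%:R + 1) + (n%:R * x) ^+ 2 * x by ring.
by rewrite addr_ge0// mulr_ge0// ?sqr_ge0// addr_ge0.
Qed.

(** Since [(1 + x) ^+ n * (1 - x) ^+ n <= 1], Bernoulli's inequality bounds the power by
    [1 / (1 - y)] with [y = n * x], and this is at most [1 + 2 * y] for [y] up to 1/2. *)
Lemma expr1D_le (R : realType) (x : R) (n : nat) : 0 <= x ->
  n%:R * x <= 2^-1 -> (1 + x) ^+ n <= 1 + 2 * (n%:R * x).
Proof.
case: n => [|n] x0 nx; first by rewrite expr0 mul0r mulr0 addr0.
have n1 : 1 <= n.+1%:R :> R by rewrite ler1n.
have x1 : 0 <= x <= 1 by nra.
have h := bernoulli_ge n.+1 x1; set y := n.+1%:R * x in nx h *.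
have y0 : 0 <= y by rewrite mulr_ge0.
have le1 : (1 + x) ^+ n.+1 * (1 - y) <= 1.
  apply: (@le_trans _ _ ((1 + x) ^+ n.+1 * (1 - x) ^+ n.+1)).
    by apply: ler_wpM2l => //; rewrite exprn_ge0// addr_ge0.
  by rewrite -exprMn exprn_ile1//; nra.
have y1 : 0 < 1 - y by lra.
rewrite -(ler_pM2r y1); apply: (le_trans le1); nra.
Qed.

Lemma expr4_le_expn2 (d : nat) : (32 <= d)%N -> (8 * d ^ 4 <= 2 ^ d)%N.
Proof.
elim: d => // d IH; rewrite leq_eqVlt => /predU1P[<-|].
  by rewrite -[32%N]/(2 ^ 5)%N -expnM -[8%N]/(2 ^ 3)%N -expnD leq_exp2l.
rewrite ltnS => d32; rewrite (expnSr 2); have {}IH := IH d32.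
apply: (@leq_trans (8 * d ^ 4 * 2)); last by rewrite leq_mul2r IH orbT.
rewrite -mulnA leq_mul2l /=.
(* Fourth powers give [d.+1 ^ 4 <= 2 * d ^ 4], because [7 ^ 4 = 2401] is below
   [2 * 6 ^ 4 = 2592]. *)
have : (6 * d.+1 <= 7 * d)%N by lia.
rewrite -(@leq_exp2r _ _ 4)// !expnMn => h.
by move: h; set u := (d.+1 ^ 4)%N; set v := (d ^ 4)%N; move: u v => u v /=; lia.
Qed.

Lemma ler_expn (R : realType) (x y : R) (n : nat) :
  0 <= x -> x <= y -> x ^+ n <= y ^+ n.
Proof.
by move=> x0 xy; apply: lerXn2r => //; rewrite nnegrE// (le_trans x0).
Qed.

(** * Tail bounds that are uniform in the number of rounds *)

Section TailBounds.
Context (R : realType) (d : nat).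
Hypothesis d32 : (32 <= d)%N.

Let d0 : (0 < d)%N. Proof. exact: leq_trans d32. Qed.
Local Notation D := (d%:R : R).
Local Notation e := (2 ^- d : R).
Local Notation a := (@round_tail R d).

Let D32 : 32 <= D. Proof. by rewrite ler_nat. Qed.

Let D_gt0 : 0 < D. Proof. by rewrite ltr0n. Qed.

Let e_gt0 : 0 < e. Proof. by rewrite invr_gt0 exprn_gt0. Qed.

Let e_ge0 : 0 <= e. Proof. exact: ltW. Qed.

(** The smallness estimates below derive from this one; trading a factor [D] for 32 produces their
    constant [256 = 8 * 32]. *)
Let D4e : 8 * D ^+ 4 * e <= 1.
Proof.
rewrite -/(_ / _) ler_pdivrMr ?exprn_gt0// mul1r -!natrX -natrM ler_nat.
exact: expr4_le_expn2.
Qed.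

Let D3e : 256 * D ^+ 3 * e <= 1.
Proof.
apply: le_trans D4e; rewrite (ler_wpM2r e_ge0)//.
rewrite (exprS D 3) mulrA ler_wpM2r ?exprn_ge0//; have := D32; lra.
Qed.

Let D2e : 256 * D ^+ 2 * e <= 1.
Proof.
apply: le_trans D3e; rewrite (ler_wpM2r e_ge0)//.
rewrite (exprS D 2) mulrA ler_wpM2r ?exprn_ge0//; have := D32; lra.
Qed.

Let D1e : 256 * D * e <= 1.
Proof.
apply: le_trans D2e; rewrite (ler_wpM2r e_ge0)//.
rewrite (exprS D 1) mulrA ler_wpM2r//; have := D32; lra.
Qed.

Let De_ge0 : 0 <= D * e. Proof. exact: mulr_ge0. Qed.

Let e_le : 256 * e <= 1.
Proof.
apply: le_trans D1e; rewrite (ler_wpM2r e_ge0)//; have := D32; lra.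
Qed.

Let D2e2_ge0 : 0 <= D ^+ 2 * e ^+ 2.
Proof. by rewrite mulr_ge0 ?exprn_ge0. Qed.

Let D2e2_le : D ^+ 2 * e ^+ 2 <= e / 256.
Proof.
rewrite (expr2 e) mulrA [leRHS]mulrC ler_wpM2r//; have := D2e; lra.
Qed.

Let D3e2_le : D ^+ 3 * e ^+ 2 <= D * e / 256.
Proof. by rewrite exprS -mulrA -(mulrA D e) ler_wpM2l. Qed.

Let D3e2_le_e : D ^+ 3 * e ^+ 2 <= e / 256.
Proof.
rewrite (expr2 e) mulrA [leRHS]mulrC ler_wpM2r//; have := D3e; lra.
Qed.

Let a_ge0 n t : 0 <= a n t. Proof. exact: conf_tail_ge0. Qed.
Let a_le1 n t : a n t <= 1. Proof. exact: conf_tail_le1. Qed.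
Let a_ni n s t : s <= t -> a n t <= a n s. Proof. exact: conf_tail_nincr. Qed.

Let expr_le_small (x : R) (m k : nat) : (m <= k)%N -> 0 <= x <= 1 ->
  x ^+ k <= x ^+ m.
Proof. by move=> mk /andP[x0 x1]; apply: ler_wiXn2l. Qed.

Let D_le : 0 <= D. Proof. by []. Qed.

(** At threshold [t + 2] every tail in the recursion is taken at [t] or beyond, so both inner powers
    are at most [a n t ^+ d]; Bernoulli's inequality then acts as the union bound over the
    maximizer's options. *)
Lemma round_tailS_le (n : nat) (t : R) : a n.+1 (t + 2) <= D * a n t ^+ d.
Proof.
rewrite round_tailS// addrK.
have M (s : R) : t <= s -> ((a n s + a n (s + 2)) / 2) ^+ d <= a n t ^+ d.
  move=> ts; apply: ler_expn; first by rewrite divr_ge0 ?addr_ge0.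
  have := a_ni n ts; have : a n (s + 2) <= a n t by apply: a_ni; lra.
  lra.
have t2 : t <= t + 2 by lra.
have m1 := M _ (lexx t); have m2 := M _ t2.
set A := _ ^+ d in m1 *; set B := _ ^+ d in m2 *.
have A0 : 0 <= A by rewrite exprn_ge0// divr_ge0 ?addr_ge0.
have B0 : 0 <= B by rewrite exprn_ge0// divr_ge0 ?addr_ge0.
have a1 : a n t ^+ d <= 1 by rewrite exprn_ile1.
have x01 : 0 <= (A + B) / 2 <= 1 by lra.
have := bernoulli_ge d x01.
have : D * ((A + B) / 2) <= D * a n t ^+ d by rewrite ler_wpM2l//; lra.
lra.
Qed.

(** Mirror image: every tail in the recursion is taken at [t + 2] or before, the union bound runs
    over the minimizer's options, and the maximizer fails only if all [d] options fail. *)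
Lemma round_tailS_ge (n : nat) (t : R) :
  1 - a n.+1 t <= (D * (1 - a n (t + 2))) ^+ d.
Proof.
rewrite round_tailS// opprB addrCA subrr addr0.
set b := a n (t + 2).
have M (s : R) : s <= t -> b ^+ d <= ((a n s + a n (s + 2)) / 2) ^+ d.
  move=> ts; apply: ler_expn; first by rewrite divr_ge0 ?addr_ge0.
  have : b <= a n (s + 2) by apply: a_ni; lra.
  have : b <= a n s by apply: a_ni; lra.
  lra.
have t2 : t - 2 <= t by lra.
have := M _ (lexx t); have := M _ t2; rewrite subrK.
have L (s : R) : ((a n s + a n (s + 2)) / 2) ^+ d <= 1.
  by rewrite exprn_ile1// ?divr_ge0 ?addr_ge0//;
     have := a_le1 n s; have := a_le1 n (s + 2); lra.
have := L t; have := L (t - 2); rewrite subrK.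
set A := _ ^+ d; set B := _ ^+ d => A1 B1 bA bB.
have b01 : 0 <= 1 - b <= 1 by rewrite subr_ge0 a_le1 gerBl a_ge0.
have := bernoulli_ge d b01; rewrite opprB addrCA subrr addr0 => h.
apply: ler_expn; lra.
Qed.

(** A cube is all that the estimates below need from such a [d]-th power. *)
Let expd_le (x y : R) : 0 <= x -> x <= y -> y <= 1 -> x ^+ d <= y ^+ 3.
Proof.
move=> x0 xy y1; apply: (@le_trans _ _ (x ^+ 3)).
  by apply: expr_le_small; [exact: leq_trans d32|lra].
by apply: ler_expn; lra.
Qed.

Lemma halfD_expr (x : R) : ((1 + x) / 2) ^+ d = e * (1 + x) ^+ d.
Proof. by rewrite expr_div_n mulrC. Qed.

(** The maximizer has [d] chances of probability about [e / 2]: a cookie +1 at the root, then [d]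
    cookies +1 for the minimizer ([p1]). A cookie -1 at the root contributes only at higher order
    ([p2]). *)
Lemma round_tail2_step (n : nat) : a n 2 <= D * e ->
  a n.+1 2 <= D / 2 * e + 2 * D ^+ 3 * e ^+ 2.
Proof.
move=> a2; rewrite round_tailS//.
have A0 := a_ge0 n 2; have A4 : a n (2 + 2) <= a n 2 by apply: a_ni; lra.
have B0 := a_ge0 n (2 + 2); have C1 := a_le1 n (2 - 2); have C0 := a_ge0 n (2 - 2).
have p1 : ((a n (2 - 2) + a n 2) / 2) ^+ d <= e * (1 + 2 * (D * a n 2)).
  apply: (@le_trans _ _ (((1 + a n 2) / 2) ^+ d)).
    by apply: ler_expn; lra.
  rewrite halfD_expr ler_pM2l//; apply: expr1D_le => //.
  have : D * a n 2 <= D * (D * e) by rewrite ler_pM2l.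
  move: D2e; rewrite expr2; lra.
have p2 : ((a n 2 + a n (2 + 2)) / 2) ^+ d <= D ^+ 2 * e ^+ 2.
  rewrite -exprMn; apply: (@le_trans _ _ ((D * e) ^+ 3)).
    by apply: expd_le; [lra|lra|have := D1e; lra].
  apply: expr_le_small => //.
  by have := D1e; have := De_ge0; lra.
have : D * a n 2 <= D * (D * e) by rewrite ler_pM2l.
move: p1 p2; set A := _ ^+ d; set B := ((_ + _) / 2) ^+ d.
move=> p1 p2 p3.
have {}p1 : A <= e * (1 + 2 * (D * (D * e))).
  by apply: (le_trans p1); rewrite ler_pM2l//; lra.
have hA0 : 0 <= A by rewrite exprn_ge0//; lra.
have hB0 : 0 <= B by rewrite exprn_ge0//; lra.
have De2 : 0 <= D ^+ 2 * e ^+ 2 by rewrite mulr_ge0// exprn_ge0// ltW.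
have hAB : (A + B) / 2 <= e / 2 + 2 * (D ^+ 2 * e ^+ 2).
  apply: (@le_trans _ _ ((e * (1 + 2 * (D * (D * e))) + D ^+ 2 * e ^+ 2) / 2)).
    lra.
  rewrite -subr_ge0.
  set l := (X in 0 <= X).
  have -> : l = (D ^+ 2 * e ^+ 2) / 2 by rewrite /l; field.
  by rewrite divr_ge0.
have x01 : 0 <= (A + B) / 2 <= 1 by have := e_le; have := D2e2_le; lra.
have := bernoulli_ge d x01.
have := ler_wpM2l D_le hAB.
have -> : D * (e / 2 + 2 * (D ^+ 2 * e ^+ 2)) = D / 2 * e + 2 * D ^+ 3 * e ^+ 2.
  by field.
lra.
Qed.

(** A negative value essentially needs all [d] root cookies to be -1, which has probability [e]. The
    power [B] is dropped, and [A] is at least [1 - 2 * D * e]. *)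
Lemma round_tail0_step (n : nat) : 1 - a n 0 <= 2 * e ->
  1 - a n.+1 0 <= e + 4 * D ^+ 2 * e ^+ 2.
Proof.
move=> q2; rewrite round_tailS// opprB addrCA subrr addr0.
have A0 := a_ge0 n 0; have A1 := a_le1 n 0.
have A2 := a_ge0 n (0 + 2).
have M1 : a n 0 <= a n (0 - 2) by apply: a_ni; lra.
have M2 : a n (0 + 2) <= a n 0 by apply: a_ni; lra.
have M3 := a_le1 n (0 - 2).
have q01 : 0 <= 1 - a n 0 <= 1 by lra.
have := bernoulli_ge d q01; rewrite opprB addrCA subrr addr0 => h.
have h1 : a n 0 ^+ d <= ((a n (0 - 2) + a n 0) / 2) ^+ d.
  by apply: ler_expn; lra.
have h2 : ((a n (0 - 2) + a n 0) / 2) ^+ d <= 1 by rewrite exprn_ile1//; lra.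
have h3 : ((a n 0 + a n (0 + 2)) / 2) ^+ d <= 1 by rewrite exprn_ile1//; lra.
have h4 : 0 <= ((a n 0 + a n (0 + 2)) / 2) ^+ d by rewrite exprn_ge0//; lra.
have Dq : D * (1 - a n 0) <= D * (2 * e) by rewrite ler_pM2l.
set A := ((_ + _) / 2) ^+ d in h1 h2 *.
set B := ((_ + _) / 2) ^+ d in h3 h4 *.
apply: (@le_trans _ _ (((1 + D * (2 * e)) / 2) ^+ d)).
  have : 0 <= D * (2 * e) by rewrite mulr_ge0//; lra.
  by move=> ?; apply: ler_expn; lra.
rewrite halfD_expr.
have -> : e + 4 * D ^+ 2 * e ^+ 2 = e * (1 + 2 * (D * (D * (2 * e)))) by ring.
rewrite ler_pM2l//; apply: expr1D_le; first by rewrite mulr_ge0//; lra.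
by move: D2e; rewrite expr2; lra.
Qed.

(** The bounds are twice the leading terms, and one step of the recursion returns the leading terms
    with an error smaller than this slack. With no rounds both left sides vanish. *)
Lemma round_tail_invariant (n : nat) : a n 2 <= D * e /\ 1 - a n 0 <= 2 * e.
Proof.
elim: n => [|n [IH1 IH2]].
  rewrite /round_tail muln0 !conf_tail0// lexx.
  rewrite (_ : (2 <= 0 :> R) = false) ?subrr; last by apply/negbTE; lra.
  by rewrite !mulr_ge0// ltW.
have h1 := round_tail2_step IH1; have h2 := round_tail0_step IH2.
have := D3e2_le; have := D2e2_le; have := e_gt0.
have : 0 <= D * e by rewrite mulr_ge0// ltW.
by split; lra.
Qed.

(** Induction on the rounds for all [j] at once: a tail [x <= D * e] becomes at most [D * x ^+ 3],
    which is at most [e * x] because [D ^+ 3 * e ^+ 2 <= e]. *)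
Lemma round_tail_right (n j : nat) : a n (2 + 2 * j%:R) <= D * e * e ^+ j.
Proof.
elim: n j => [|n IH] j.
  rewrite /round_tail muln0 conf_tail0// (_ : (_ <= 0)%R = false).
    by rewrite !mulr_ge0// ?exprn_ge0// ltW.
  by apply/negbTE; have : 0 <= j%:R :> R by []; lra.
case: j => [|j]; first by rewrite mulr0 addr0 expr0 mulr1;
  have [] := round_tail_invariant n.+1.
have -> : 2 + 2 * j.+1%:R = 2 + 2 * j%:R + 2 :> R by rewrite -natr1; ring.
apply: (le_trans (round_tailS_le _ _)); have {}IH := IH j.
rewrite [e ^+ j.+1]exprS (mulrCA (D * e)).
have A0 := a_ge0 n (2 + 2 * j%:R).
have : a n (2 + 2 * j%:R) <= a n 2.
  by apply: a_ni; have : 0 <= j%:R :> R by []; lra.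
have [+ _] := round_tail_invariant n; move: A0 IH.
set x := a n _ => x0 IH y1 y2.
have x1 : x <= D * e by lra.
have De1 : D * e <= 1 by have := D1e; lra.
apply: (@le_trans _ _ (D * x ^+ 3)).
  by rewrite ler_wpM2l//; apply: expd_le => //; lra.
apply: (@le_trans _ _ (e * x)); last by rewrite ler_pM2l.
rewrite exprSr mulrA ler_wpM2r//.
apply: (@le_trans _ _ (D * (D * e) ^+ 2)).
  by rewrite ler_wpM2l//; apply: ler_expn => //; lra.
have -> : D * (D * e) ^+ 2 = D ^+ 3 * e ^+ 2 by ring.
have := D3e2_le_e; have := e_gt0; lra.
Qed.

(** Same scheme, with [(D * y) ^+ 3 <= e * y] for [0 <= y <= 2 * e]. *)
Lemma round_tail_left (n j : nat) : 1 - a n (- (2 * j%:R)) <= 2 * e * e ^+ j.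
Proof.
elim: n j => [|n IH] j.
  rewrite /round_tail muln0 conf_tail0// oppr_le0 mulr_ge0// subrr.
  by rewrite !mulr_ge0// ?exprn_ge0// ltW.
case: j => [|j]; first by rewrite mulr0 oppr0 expr0 mulr1;
  have [] := round_tail_invariant n.+1.
apply: (le_trans (round_tailS_ge _ _)); have {}IH := IH j.
have -> : - (2 * j.+1%:R) + 2 = - (2 * j%:R) :> R by rewrite -natr1; ring.
rewrite [e ^+ j.+1]exprS (mulrCA (2 * e)).
have A1 := a_le1 n (- (2 * j%:R)).
have : a n 0 <= a n (- (2 * j%:R)).
  by apply: a_ni; have : 0 <= j%:R :> R by []; lra.
have [_] := round_tail_invariant n; move: A1 IH.
set x := a n _ => A1 IH y1 y2.
have x0 : 0 <= 1 - x by lra.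
have x1 : 1 - x <= 2 * e by lra.
have Dx : D * (1 - x) <= D * (2 * e) by rewrite ler_wpM2l.
have De1 : D * (2 * e) <= 1 by have := D1e; lra.
apply: (@le_trans _ _ ((D * (1 - x)) ^+ 3)).
  by apply: expd_le => //; [rewrite mulr_ge0|lra].
apply: (@le_trans _ _ (e * (1 - x))); last by rewrite ler_pM2l.
rewrite exprMn (exprSr (1 - x)) mulrA ler_wpM2r//.
apply: (@le_trans _ _ (D ^+ 3 * (2 * e) ^+ 2)).
  by rewrite ler_wpM2l ?exprn_ge0//; apply: ler_expn; lra.
rewrite exprMn mulrCA; have := D3e2_le_e; have := e_gt0; lra.
Qed.

(** Only the power [A], from root cookies +1, is kept. Bounding [1 - (1 - y) ^+ d] from below takes
    the second-order inequality [bernoulli_le], whose square is of order [D ^+ 2 * e ^+ 2]. *)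
Lemma round_tail2_lower (n : nat) :
  D / 2 * e - 2 * D ^+ 3 * e ^+ 2 <= a n.+1 2.
Proof.
rewrite round_tailS// subrr.
have [_ q2] := round_tail_invariant n.
have A0 := a_ge0 n 0; have A1 := a_le1 n 0; have A2 := a_ge0 n 2.
have A4 := a_ge0 n (2 + 2).
set A := ((_ + _) / 2) ^+ d; set B := ((_ + _) / 2) ^+ d.
have hA : e * (1 - 2 * D * e) <= A.
  apply: (@le_trans _ _ (e * a n 0 ^+ d)).
    rewrite ler_pM2l//.
    have q01 : 0 <= 1 - a n 0 <= 1 by lra.
    have := bernoulli_ge d q01; rewrite opprB addrCA subrr addr0.
    have : D * (1 - a n 0) <= D * (2 * e) by rewrite ler_pM2l.
    lra.
  rewrite mulrC -expr_div_n; apply: ler_expn; lra.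
have hA1 : A <= 1 by rewrite exprn_ile1//; have := a_le1 n 2; lra.
have hB : 0 <= B by rewrite exprn_ge0//; lra.
have hB1 : B <= 1.
  by rewrite exprn_ile1//; have := a_le1 n 2; have := a_le1 n (2 + 2); lra.
set y := e * (1 - 2 * D * e) / 2.
have y0 : 0 <= y.
  by rewrite divr_ge0 ?mulr_ge0//; have := D1e; lra.
have y1 : y <= e / 2.
  rewrite ler_pM2r ?invr_gt0// ger_pMr//; have := De_ge0; lra.
have y01 : 0 <= y <= 1 by have := e_le; lra.
have hAB : y <= (A + B) / 2 by rewrite /y; lra.
have : (1 - (A + B) / 2) ^+ d <= (1 - y) ^+ d.
  by apply: ler_expn; lra.
have := bernoulli_le d y01.
have : (D * y) ^+ 2 <= (D * (e / 2)) ^+ 2.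
  by apply: ler_expn; [rewrite mulr_ge0|rewrite ler_wpM2l].
have -> : D * y = D / 2 * e - D ^+ 2 * e ^+ 2 by rewrite /y; field.
have -> : (D * (e / 2)) ^+ 2 = D ^+ 2 * e ^+ 2 / 4 by field.
have : 32 * (D ^+ 2 * e ^+ 2) <= D ^+ 3 * e ^+ 2.
  by rewrite (exprS D 2) -mulrA ler_wpM2r.
have := D2e2_ge0; set u := (_ - _) ^+ 2.
lra.
Qed.

(** Even if every option behind a +1 succeeded, one behind a -1 succeeds with probability at most
    [2 * e], so all [d] fail with probability at least [((1 - 2 * e) / 2) ^+ d]. *)
Lemma round_tail0_lower (n : nat) :
  e - D ^+ 3 * e ^+ 2 <= 1 - a n.+1 0.
Proof.
rewrite round_tailS// opprB addrCA subrr addr0.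
have [q1 q2] := round_tail_invariant n.
have A0 := a_ge0 n 0; have A1 := a_le1 n 0; have A2 := a_ge0 n (0 + 2).
have A3 := a_ge0 n (0 - 2); have A4 := a_le1 n (0 - 2).
have p2 : a n (0 + 2) <= D * e by rewrite add0r.
set A := ((_ + _) / 2) ^+ d; set B := ((_ + _) / 2) ^+ d.
have hA1 : A <= 1 by rewrite exprn_ile1//; lra.
have De0 : 0 <= D * e by rewrite mulr_ge0// ltW.
have hB : B <= 2 * e.
  apply: (@le_trans _ _ (((1 + D * e) / 2) ^+ d)).
    by apply: ler_expn; lra.
  rewrite halfD_expr (mulrC 2) ler_pM2l//.
  have h : D * (D * e) <= 2^-1 by move: D2e; rewrite expr2; lra.
  by apply: (le_trans (expr1D_le De0 h)); lra.
have := D1e => D1e'.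
apply: (@le_trans _ _ (((1 - 2 * e) / 2) ^+ d)); last first.
  by apply: ler_expn; have := e_le; lra.
have e01 : 0 <= 2 * e <= 1 by have := e_gt0; have := e_le; lra.
have := bernoulli_ge d e01; rewrite expr_div_n => h.
rewrite [leRHS]mulrC.
apply: (@le_trans _ _ (e * (1 - D * (2 * e)))); last by rewrite ler_pM2l.
have : 2 * (D * e ^+ 2) <= D ^+ 3 * e ^+ 2.
  rewrite mulrA ler_wpM2r ?sqr_ge0//.
  rewrite exprSr ler_wpM2r//.
  apply: (@le_trans _ _ (D ^+ 1)); first by rewrite expr1; have := D32; lra.
  by rewrite ler_weXn2l// ler1n.
by rewrite (expr2 e); lra.
Qed.

End TailBounds.

(** * Cookies on the tree read as finite configurations *)

Fixpoint lookup (d k : nat) : conf d k -> seq 'I_d -> 'I_d -> bool :=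
  match k return conf d k -> seq 'I_d -> 'I_d -> bool with
  | 0 => fun _ _ _ => false
  | k'.+1 => fun (c : {ffun 'I_d -> bool * conf d k'}) u i =>
    if u is j :: u' then lookup (c j).2 u' i else (c i).1
  end.

Section Agreement.
Context (R : realType) (d : nat).
Implicit Types (x : edge d -> R) (v : vertex d).

(** The bound on [size u] keeps the default [false] of [lookup] from being read. *)
Definition agrees x (k : nat) v (c : conf d k) : Prop :=
  forall u i, (size u < k)%N -> x (v ++ u, i) = (-1) ^+ lookup c u i.

Lemma agreesS x (k : nat) v (c : {ffun 'I_d -> bool * conf d k}) :
  @agrees x k.+1 v c ->
  forall i, x (v, i) = (-1) ^+ (c i).1 /\ agrees x (rcons v i) (c i).2.
Proof.
move=> xc i; split; first by have := xc [::] i isT; rewrite cats0.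
by move=> u j uk; rewrite cat_rcons (xc (i :: u) j).
Qed.

Lemma game_rec_agrees x (k : nat) v (c : conf d k) :
  agrees x v c -> game_rec x k v = conf_val R (odd (size v)) c.
Proof.
elim: k v c => //= k IH v c /agreesS xc.
have -> : [seq x (v, i) + game_rec x k (rcons v i) | i <- enum 'I_d] =
    [seq (-1) ^+ (c i).1 + conf_val R (~~ odd (size v)) (c i).2
    | i <- enum 'I_d].
  apply: eq_map => i; have [-> xi] := xc i.
  by rewrite (IH _ _ xi) size_rcons.
by [].
Qed.

(** Every cookie other than -1 is recorded as +1, so the result agrees with [x] once all cookies are
    signs. *)
Fixpoint conf_of x (k : nat) v : conf d k :=
  match k return conf d k with
  | 0 => tt
  | k'.+1 => [ffun i => (x (v, i) == -1, conf_of x k' (rcons v i))]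
  end.

Lemma agrees_conf_of x (k : nat) v :
  (forall e, x e = 1 \/ x e = -1) -> agrees x v (conf_of x k v).
Proof.
move=> x1; elim: k v => // k IH v [|j u] i /= uk; rewrite ffunE /=.
  rewrite cats0; case: (x1 (v, i)) => ->; rewrite ?eqxx//.
  by rewrite -subr_eq0 opprK -mulr2n pnatr_eq0.
by rewrite -cat_rcons; apply: IH.
Qed.

(** Makes the events of distinct configurations disjoint. *)
Lemma agrees_unique x (k : nat) v (c : conf d k) :
  agrees x v c -> c = conf_of x k v.
Proof.
elim: k v c => [v []//|k IH v c /agreesS xc]; apply/ffunP => i.
have [xi /IH ci] := xc i; rewrite ffunE xi -/(conf_of _ _ _) -ci.
by case: (c i) => -[] b /=; rewrite ?expr1 ?eqxx// expr0 -subr_eq0 opprK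
  -mulr2n pnatr_eq0.
Qed.

Definition words (k : nat) : seq (seq 'I_d) :=
  flatten [seq [seq tval t | t <- enum {: j.-tuple 'I_d}] | j <- iota 0 k].

Lemma mem_words (k : nat) (u : seq 'I_d) : (u \in words k) = (size u < k)%N.
Proof.
apply/flatten_mapP/idP => [[j]|uk].
  by rewrite mem_iota => jk /mapP[t _ ->]; rewrite size_tuple.
exists (size u); first by rewrite mem_iota.
by apply/mapP; exists (in_tuple u); rewrite ?mem_enum.
Qed.

(** Duplicate-free, as the product formula in [mutually_independent] demands of its index list. *)
Definition edges_upto (k : nat) : seq (edge d) :=
  undup [seq (u, i) | u <- words k, i <- enum 'I_d].

Lemma mem_edges_upto (k : nat) (e : edge d) :
  (e \in edges_upto k) = (size e.1 < k)%N.
Proof.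
rewrite mem_undup -mem_words; apply/allpairsP/idP => [[[u i] [uk _ ->]]//|ek].
by exists e; rewrite mem_enum; split => //; case: e {ek}.
Qed.

Lemma agreesE x (k : nat) (c : conf d k) :
  agrees x [::] c <->
  forall e, e \in edges_upto k -> x e = (-1) ^+ lookup c e.1 e.2.
Proof.
split=> [xc [u i]|xc u i uk]; first by rewrite mem_edges_upto => /(xc u i).
by apply: (xc (u, i)); rewrite mem_edges_upto.
Qed.

End Agreement.

(** * Measurability and the law of [V_n] *)

Lemma measurable_bigmax (disp : measure_display) (T : measurableType disp)
    (R : realType) (I : eqType) (f : I -> T -> R) (s : seq I) :
  (forall i, measurable_fun setT (f i)) ->
  measurable_fun setT (fun w => seq_max [seq f i w | i <- s]).
Proof.
move=> mf; pose h w := head 0 [seq f i w | i <- s].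
have mh : measurable_fun setT h by rewrite {}/h; case: s => [|i r] /=.
have -> : (fun w => seq_max [seq f i w | i <- s]) =
    (fun w => \big[Num.max/h w]_(i <- s) f i w).
  by apply/funext => w; rewrite /seq_max big_map.
(* The start [h] of the fold depends on the outcome but stays fixed while the list is taken
   apart. *)
elim: {1}s => [|i r IH]; first by under eq_fun do rewrite big_nil.
by under eq_fun do rewrite big_cons; exact: measurable_maxr.
Qed.

Lemma measurable_bigmin (disp : measure_display) (T : measurableType disp)
    (R : realType) (I : eqType) (f : I -> T -> R) (s : seq I) :
  (forall i, measurable_fun setT (f i)) ->
  measurable_fun setT (fun w => seq_min [seq f i w | i <- s]).
Proof.
move=> mf; pose h w := head 0 [seq f i w | i <- s].
have mh : measurable_fun setT h by rewrite {}/h; case: s => [|i r] /=.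
have -> : (fun w => seq_min [seq f i w | i <- s]) =
    (fun w => \big[Num.min/h w]_(i <- s) f i w).
  by apply/funext => w; rewrite /seq_min big_map.
elim: {1}s => [|i r IH]; first by under eq_fun do rewrite big_nil.
by under eq_fun do rewrite big_cons; exact: measurable_minr.
Qed.

Section RoundLaw.
Context (disp : measure_display) (T : measurableType disp) (R : realType).
Variables (P : probability T R) (d : nat) (X : edge d -> {RV P >-> R}).
Hypothesis iidX : iid_cookies X.

Lemma measurable_game_rec (k : nat) (v : vertex d) :
  measurable_fun setT (fun w => game_rec (fun e => X e w) k v).
Proof.
elim: k v => [|k IH] v /=; first exact: measurable_cst.
have mf (i : 'I_d) : measurable_fun setT
    (fun w => X (v, i) w + game_rec (fun e => X e w) k (rcons v i)).
  by apply: measurable_funD.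
by case: (odd _); [exact: measurable_bigmin|exact: measurable_bigmax].
Qed.

Lemma measurable_round_value (n : nat) :
  measurable_fun setT (round_value X n).
Proof. exact: measurable_game_rec. Qed.

Definition conf_event (k : nat) (c : conf d k) : set T :=
  [set w | agrees (fun e => X e w) [::] c].

Lemma conf_eventE (k : nat) (c : conf d k) : conf_event c =
  \bigcap_(e in [set` edges_upto d k])
    (X e @^-1` [set (-1) ^+ lookup c e.1 e.2]).
Proof. by apply/seteqP; split => w /= /agreesE. Qed.

Lemma measurable_conf_event (k : nat) (c : conf d k) :
  measurable (conf_event c).
Proof.
rewrite conf_eventE; apply: fin_bigcap_measurable => [|e _].
  exact: finite_seq.
by rewrite -[X in measurable X]setTI; exact: measurable_funP.
Qed.

Lemma conf_event_prob (k : nat) (c : conf d k) :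
  P (conf_event c) = (2^-1 ^+ size (edges_upto d k))%:E.
Proof.
have [indX uX] := iidX; rewrite conf_eventE.
rewrite (indX _ (fun e => [set (-1) ^+ lookup c e.1 e.2]))//; last first.
  exact: undup_uniq.
transitivity (\prod_(e <- edges_upto d k) (2^-1 : R)%:E)%E.
  apply: eq_bigr => e _; have [h1 hN1] := uX e.
  by case: (lookup c e.1 e.2); rewrite ?expr0 ?expr1.
elim: (edges_upto d k) => [|e r IH]; first by rewrite big_nil expr0.
by rewrite big_cons IH /= exprS EFinM.
Qed.

Lemma ae_sign : {ae P, forall w, forall e, X e w = 1 \/ X e w = -1}.
Proof.
have [_ uX] := iidX.
have H e : {ae P, forall w, X e w = 1 \/ X e w = -1}.
  have m (r : R) : measurable (X e @^-1` [set r]).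
    by rewrite -[X in measurable X]setTI; exact: measurable_funP.
  exists (~` (X e @^-1` [set 1] `|` X e @^-1` [set -1])); split => //.
  - by apply: measurableC; exact: measurableU.
  - rewrite probability_setC; last exact: measurableU.
    suff -> : P (X e @^-1` [set 1] `|` X e @^-1` [set -1]) = 1%E.
      by rewrite subee.
    transitivity (P (X e @^-1` [set 1%R]) + P (X e @^-1` [set (-1)%R]))%E.
      apply: measureU => //; apply/seteqP; split => // w /= [->] /eqP.
      by rewrite -subr_eq0 opprK -mulr2n pnatr_eq0.
    have [-> ->] := uX e; rewrite -EFinD; congr EFin; lra.
(* The edges are countable: [unpickle] enumerates them, so countably many null sets are united. *)
have Hn (n : nat) : {ae P, forall w,
    forall e, unpickle n = Some e -> X e w = 1 \/ X e w = -1}.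
  case: (unpickle n) => [e|]; last exact: aeW.
  by apply: filterS (H e) => w he _ [<-].
by apply: filterS (ae_foralln Hn) => w he e; apply: (he (pickle e)); rewrite pickleK.
Qed.

(* The configurations are equally likely and almost surely exactly one of them
   occurs, so the common value of their probabilities need not be computed. *)
Lemma round_prob (n : nat) (A : set R) : measurable A ->
  P (round_value X n @^-1` A) =
  (freq R (fun c : conf d (2 * n) => `[< A (conf_val R false c) >]))%:E.
Proof.
move=> mA; set k := (2 * n)%N.
set q : R := 2^-1 ^+ size (edges_upto d k).
suff count B : measurable B -> P (round_value X n @^-1` B) =
    (#|(fun c : conf d k => `[< B (conf_val R false c) >]) : pred _|%:R * q)%:E.
  have := count setT measurableT; rewrite preimage_setT probability_setT => -[].
  rewrite (eq_card (B := conf d k)); last by move=> c; rewrite inE; apply/asboolP.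
  move=> q1; rewrite (count _ mA); congr EFin.
  rewrite /freq; congr (_ * _).
  have c0 : #|conf d k|%:R != 0 :> R by rewrite pnatr_eq0 -lt0n card_conf.
  by apply: (mulfI c0); rewrite -q1 divff.
move=> mB; set V := _ @^-1` B.
have mV : measurable V.
  by rewrite -[V]setTI; exact: measurable_round_value.
pose E (c : conf d k) := V `&` conf_event c.
have mE c : measurable (E c) by apply: measurableI => //; exact: measurable_conf_event.
have VE : P V = P (\bigcup_(c in [set` enum (conf d k)]) E c).
  apply/eqP; rewrite eq_le; apply/andP; split; last first.
    apply: le_measure; rewrite ?inE//.
      by apply: fin_bigcup_measurable => //; exact: finite_seq.
    by move=> w [c _ []].
  have [N [mN N0 sN]] := ae_sign.
  have mU : measurable (\bigcup_(c in [set` enum (conf d k)]) E c).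
    by apply: fin_bigcup_measurable => //; exact: finite_seq.
  rewrite -(measureU0 mU mN N0); apply: le_measure; rewrite ?inE//.
    exact: measurableU.
  move=> w Vw; have [w1|] := pselect (forall e, X e w = 1 \/ X e w = -1).
    left; exists (conf_of (fun e => X e w) k [::]); first by rewrite /= mem_enum.
    by split => //; exact: agrees_conf_of.
  by move=> w1; right; exact: sN.
have Eval (c : conf d k) w : conf_event c w -> round_value X n w = conf_val R false c.
  by move=> /game_rec_agrees cw; rewrite /round_value /game_value subn0 -/k cw.
rewrite VE measure_fin_bigcup//=.
  rewrite -fsbig_seq ?enum_uniq//.
  transitivity (\sum_(c <- enum (conf d k))
      (if `[< B (conf_val R false c) >] then q else 0)%:E)%E.
    apply: eq_bigr => c _; case: asboolP => Bc.
      rewrite -(conf_event_prob c); congr (P _).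
      by apply/seteqP; split => [w []//|w cw]; split => //; rewrite /V/= (Eval c).
    rewrite (_ : E c = set0) ?measure0//; apply/seteqP; split => // w [Vw cw].
    by apply: Bc; rewrite -(Eval c w cw).
  by rewrite sumEFin big_enum /= -big_mkcond /= sumr_const mulr_natl.
move=> c c' _ _ [w [[_ /agrees_unique cw] [_ /agrees_unique c'w]]].
by rewrite cw -c'w.
Qed.

End RoundLaw.

(** * Even-valued sequences, point masses and far tails *)

Lemma even_cvg_eventually (R : realType) (u : nat -> R) (l : R) :
  (forall n, exists z : int, u n = 2 * z%:~R) -> u n @[n --> \oo] --> l ->
  \forall n \near \oo, u n = l.
Proof.
(* Two terms within 1/2 of [l] are less than 1 apart, and even integers that close coincide. *)
move=> uz ul; have h2 : 0 < 2^-1 :> R by rewrite invr_gt0.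
have /cvgrPdist_lt/(_ _ h2)[N _ uN] := ul.
have cstN n : (N <= n)%N -> u n = u N.
  move=> Nn; have := uN _ Nn; have := uN _ (leqnn N) => /=.
  have [z ->] := uz n; have [z' ->] := uz N => h h'.
  have : `|(z - z')%:~R| < 1 :> R.
    rewrite rmorphB /= ltr_norml; move: h h'; rewrite !ltr_norml.
    by move=> /andP[? ?] /andP[? ?]; apply/andP; split; lra.
  by rewrite -intr_norm -[ltRHS]/(1%:~R) ltr_int => h1; congr (2 * _%:~R); lia.
have ulN : u n @[n --> \oo] --> u N.
  by apply: cvg_near_cst; exists N => // n /= /cstN.
have -> : l = u N by exact: (cvg_unique (@Rhausdorff R) ul ulN).
by exists N => // n /= /cstN.
Qed.

Lemma freq_orb_le (R : realType) (T : finType) (p q : pred T) :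
  freq R (fun x => p x || q x) <= freq R p + freq R q.
Proof.
rewrite /freq -mulrDl ler_wpM2r ?invr_ge0// -natrD ler_nat.
by rewrite -cardUI; apply: leq_addr.
Qed.

Lemma freq_orb (R : realType) (T : finType) (p q : pred T) :
  (forall x, ~~ (p x && q x)) ->
  freq R (fun x => p x || q x) = freq R p + freq R q.
Proof.
move=> pq; rewrite /freq -mulrDl -natrD -cardUI; congr (_%:R / _).
by rewrite [X in (_ + X)%N]eq_card0 ?addn0// => x; apply/negbTE/pq.
Qed.

Lemma indic_set1 (R : realType) (x y : R) : \1_[set y] x = (x == y)%:R :> R.
Proof.
rewrite indicE; suff -> : (x \in [set y]) = (x == y) by [].
by apply/idP/eqP; rewrite inE.
Qed.

(** All values are even, so a point mass is the difference of two tails at consecutive even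
    thresholds. *)
Lemma freq_point (R : realType) (d n : nat) (m : int) : (0 < d)%N ->
  freq R (fun c : conf d (2 * n) =>
    `[< [set 2 * m%:~R] (conf_val R false c) >]) =
  round_tail d n (2 * m%:~R) - round_tail d n (2 * m%:~R + 2).
Proof.
move=> d_gt0; apply/eqP; rewrite eq_sym subr_eq; apply/eqP.
rewrite /round_tail /conf_tail -freq_orb; last first.
  by move=> c; apply/negP => /andP[/asboolP/= ->]; rewrite gerDl; lra.
apply: freq_eq => c; have [z ->] := conf_val_int R d_gt0 false c.
have -> : 2 * m%:~R + 2 = 2 * (m + 1)%:~R :> R by rewrite intrD mulrDr mulr1.
rewrite mul2n odd_double add0r.
rewrite !ler_pM2l// !ler_int.
apply/idP/idP => [mz|/orP[/asboolP/= h|]]; last 2 first.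
- by move: h => /(mulfI _) h; rewrite -(ler_int R) h// pnatr_eq0.
- by lia.
have [->|mz'] := eqVneq z m; first by apply/orP; left; apply/asboolP.
by apply/orP; right; lia.
Qed.

(** The cut-offs match [round_tail_left] and [round_tail_right]; the even numbers left out are those
    from [- (2 * j)] to [2 * j]. *)
Definition outside (R : realType) (j : nat) : set R :=
  [set x | x < - (2 * j%:R)] `|` [set x | 2 + 2 * j%:R <= x].

Lemma measurable_outside (R : realType) (j : nat) :
  measurable (@outside R j).
Proof.
apply: measurableU.
  by rewrite -set_itvNyo; exact: measurable_itv.
by rewrite -set_itvcy; exact: measurable_itv.
Qed.

Lemma freq_outside (R : realType) (d n j : nat) :
  freq R (fun c : conf d (2 * n) => `[< outside j (conf_val R false c) >]) <=
  1 - round_tail d n (- (2 * j%:R)) + round_tail d n (2 + 2 * j%:R).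
Proof.
rewrite /round_tail /conf_tail -freqC ?card_conf//.
apply: le_trans (freq_orb_le _ _ _); apply: freq_le => c /asboolP[] /= h.
  by rewrite -ltNge h.
by rewrite h orbT.
Qed.

(* If [`|x| = 2 * (k + 2)], the single term [j = k] already dominates, because
   [2 * (k + 2) <= 2 ^ (k + 2)]; the geometric weights keep the series summable
   against the tails of the limit. *)
Lemma even_outside (R : realType) (x : R) (z : int) : x = 2 * z%:~R ->
  (`|x - 2 * (\1_[set 2] x - \1_[set (-2)] x)|%:E <=
   \sum_(j <oo) (2 ^+ j.+2 * \1_(outside j.+1) x)%:E)%E.
Proof.
move=> xz.
have t0 j : (0 <= (2 ^+ j.+2 * \1_(outside j.+1) x)%:E)%E.
  by rewrite lee_fin mulr_ge0.
(* The values -2, 0 and 2 are reproduced exactly by the two indicators, which makes the left side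
   vanish. *)
have [z1|z1] := leP `|z| 1.
  rewrite (_ : x - _ = 0); last first.
    have : z = 1 \/ z = -1 \/ z = 0 by lia.
    have n1 : (-2 == 2 :> R) = false by apply/negbTE; lra.
    have n2 : (2 == -2 :> R) = false by apply/negbTE; lra.
    have n3 : (0 == -2 :> R) = false by apply/negbTE; lra.
    have n4 : (0 == 2 :> R) = false by apply/negbTE; lra.
    rewrite xz !indic_set1.
    case=> [->|[->|->]].
    - by rewrite mulr1 eqxx n2 subr0 mulr1 subrr.
    - by rewrite mulrN1 eqxx n1 sub0r mulrN1 opprK addNr.
    - by rewrite mulr0 n3 n4 subrr mulr0 subrr.
  by rewrite normr0; apply: nneseries_ge0.
have [k zk] : exists k : nat, `|z| = k.+2 :> int by exists (`|z|%N - 2)%N; lia.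
have xo : outside k.+1 x.
  have [z0|z0] := leP 0 z.
    right; rewrite /= xz (_ : z = k.+2%:Z); last by lia.
    by rewrite -pmulrn -(natr1 k.+1); lra.
  left; rewrite /= xz (_ : z = - k.+2%:Z); last by lia.
  by rewrite rmorphN /= -pmulrn -(natr1 k.+1); lra.
apply: (@le_trans _ _ (2 ^+ k.+2)%:E); last first.
  apply: le_trans (nneseries_lim_ge k.+1 _); last by [].
  rewrite big_nat_recr//=; apply: (@le_trans _ _ (2 ^+ k.+2 * \1_(outside k.+1) x)%:E).
    by rewrite indicE mem_set ?mulr1.
  by rewrite leeDr// sume_ge0.
rewrite lee_fin !indic_set1.
have z2 : (x == 2) = false.
  by apply/negbTE/eqP; rewrite xz -[RHS]mulr1 => /mulfI; rewrite pnatr_eq0 => /(_ isT)/eqP;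
   rewrite (eqr_int R z 1); lia.
have z3 : (x == -2) = false.
  by apply/negbTE/eqP; rewrite xz -[RHS]mulrN1 => /mulfI; rewrite pnatr_eq0 => /(_ isT)/eqP;
   rewrite (eqr_int R z (-1)); lia.
rewrite z2 z3 subrr mulr0 subr0 xz normrM ger0_norm// -intr_norm zk -pmulrn.
rewrite exprS ler_pM2l// -natrX ler_nat; exact: ltn_expl.
Qed.

(** * Convergence in law to the limit *)

Section Limit.
Context (disp : measure_display) (T : measurableType disp) (R : realType).
Variables (P : probability T R) (d : nat) (X : edge d -> {RV P >-> R}).
Variable Vinf : {RV P >-> R}.
Hypotheses (d_gt0 : (0 < d)%N) (iidX : iid_cookies X).
Hypothesis VinfP :
  {ae P, forall w, round_value X n w @[n --> \oo] --> Vinf w}.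

Lemma limit_attained : {ae P, forall w, (exists z : int, Vinf w = 2 * z%:~R) /\
  \forall n \near \oo, round_value X n w = Vinf w}.
Proof.
apply: filterS2 (ae_sign iidX) VinfP => w w1 wV.
have even n : exists z : int, round_value X n w = 2 * z%:~R.
  have := game_rec_agrees (@agrees_conf_of R d (X^~ w) (2 * n) [::] w1).
  rewrite /round_value /game_value subn0 => ->.
  have [z ->] := conf_val_int R d_gt0 (odd 0) (conf_of (X^~ w) (2 * n) [::]).
  by exists z; rewrite mul2n odd_double add0r.
have ev := even_cvg_eventually even wV.
split => //; case: ev => N _ /(_ N (leqnn N)) <-; exact: even.
Qed.

(** Almost surely the indicators of the events are eventually equal to that of the limit event, so
    dominated convergence with bound 1 applies. *)
Lemma limit_law (A : set R) : measurable A ->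
  P (round_value X n @^-1` A) @[n --> \oo] --> P (Vinf @^-1` A).
Proof.
move=> mA.
have mB n : measurable (round_value X n @^-1` A).
  by rewrite -[X in measurable X]setTI; exact: measurable_round_value.
have mV : measurable (Vinf @^-1` A).
  by rewrite -[X in measurable X]setTI; exact: measurable_funP.
have [] := @dominated_convergence _ _ _ P setT measurableT
  (fun n w => (\1_(round_value X n @^-1` A) w)%:E)
  (fun w => (\1_(Vinf @^-1` A) w)%:E) (cst 1%E).
- by move=> n; apply/measurable_EFinP; exact: measurable_indic.
- by apply/measurable_EFinP; exact: measurable_indic.
- apply: filterS limit_attained => w [_ wV] _.
  apply: cvg_near_cst; apply: filterS wV => n wn.
  have mem f : (w \in f @^-1` A) = (f w \in A) by apply/idP/idP; rewrite !inE.
  by rewrite !indicE !mem wn.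
- exact: finite_measure_integrable_cst.
- apply: aeW => w n _ /=; rewrite lee_fin indicE.
  by case: (_ \in _); rewrite ?normr1 ?normr0.
move=> _ _; rewrite integral_indic// setIT.
by under eq_fun do rewrite integral_indic// setIT.
Qed.

Lemma limit_prob_bounds (A : set R) (l u : R) : measurable A ->
  (forall n, l <= freq R (fun c : conf d (2 * n.+1) =>
    `[< A (conf_val R false c) >]) <= u) ->
  (l%:E <= P (Vinf @^-1` A) <= u%:E)%E.
Proof.
(* The estimates start at one round, hence the shifted sequence. *)
move=> mA lu; have := limit_law mA; rewrite -cvg_shiftS => h.
by apply/andP; split; [apply: cvge_ge h|apply: cvge_le h]; apply: nearW => n;
  rewrite /= (round_prob iidX)// lee_fin; have /andP[] := lu n.
Qed.

End Limit.

(** * Asymptotics of the limit law and of its mean *)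

Lemma abse_sub_le (R : realType) (y : \bar R) (c r : R) :
  ((c - r)%:E <= y <= (c + r)%:E)%E -> (`|y - c%:E| <= r%:E)%E.
Proof.
case: y => [y||]; rewrite ?leeNy_eq ?leye_eq ?andbF//.
by rewrite !lee_fin ler_norml => /andP[? ?]; apply/andP; split; lra.
Qed.

Lemma half_series_le (R : realType) (K : R) (f : nat -> \bar R) : 0 <= K ->
  (forall j, 0 <= f j <= (K * 2^-1 ^+ j)%:E)%E ->
  (\sum_(j <oo) f j <= (2 * K)%:E)%E.
Proof.
move=> K0 fK; apply: lime_le.
  by apply: is_cvg_nneseries => j _ _; have /andP[] := fK j.
apply: nearW => n.
(* The induction runs on the exact geometric partial sum. *)
suff : (\sum_(0 <= j < n) f j <= (2 * K * (1 - 2^-1 ^+ n))%:E)%E.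
  by move=> /le_trans; apply; rewrite lee_fin ler_piMr ?mulr_ge0.
elim: n => [|n IH]; first by rewrite big_geq// expr0 subrr mulr0.
rewrite big_nat_recr//=; have /andP[_ fn] := fK n.
apply: le_trans (leeD IH fn) _; rewrite -EFinD lee_fin exprS; lra.
Qed.

Lemma integral_indic_preimage (disp : measure_display)
    (T : measurableType disp) (R : realType) (P : probability T R)
    (V : {RV P >-> R}) (A : set R) : measurable A ->
  (\int[P]_w (\1_A (V w))%:E = P (V @^-1` A))%E.
Proof.
move=> mA; have mV : measurable (V @^-1` A).
  by rewrite -[X in measurable X]setTI; exact: measurable_funP.
by rewrite -[in RHS](setIT (V @^-1` A)) -integral_indic.
Qed.

Section LimitAsymptotics.
Context (disp : measure_display) (T : measurableType disp) (R : realType).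
Variables (P : probability T R) (d : nat) (X : edge d -> {RV P >-> R}).
Variable Vinf : {RV P >-> R}.
Hypotheses (d32 : (32 <= d)%N) (iidX : iid_cookies X).
Hypothesis VinfP :
  {ae P, forall w, round_value X n w @[n --> \oo] --> Vinf w}.

Local Notation D := (d%:R : R).
Local Notation e := (2 ^- d : R).
Local Notation a := (@round_tail R d).

Let d_gt0 : (0 < d)%N. Proof. exact: leq_trans d32. Qed.

Let D_ge32 : 32 <= D. Proof. by rewrite ler_nat. Qed.

Let e_gt0 : 0 < e. Proof. by rewrite invr_gt0 exprn_gt0. Qed.

Let e_le : 4 * e <= 1.
Proof.
rewrite ler_pdivrMr ?exprn_gt0// mul1r -natrX ler_nat.
by rewrite -[4%N]/(2 ^ 2)%N leq_exp2l// (leq_trans _ d32).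
Qed.

Let e2_ge0 : 0 <= e ^+ 2. Proof. exact: sqr_ge0. Qed.

Let e2_le : 1024 * (D * e ^+ 2) <= D ^+ 3 * e ^+ 2.
Proof.
rewrite mulrA (ler_wpM2r e2_ge0)// exprSr ler_wpM2r//.
have -> : 1024 = 32 ^+ 2 :> R by rewrite -natrX.
by apply: ler_expn.
Qed.

Let D2e2_le : 32 * (D ^+ 2 * e ^+ 2) <= D ^+ 3 * e ^+ 2.
Proof. by rewrite (exprS D 2) -mulrA ler_wpM2r// mulr_ge0. Qed.

Let De2_ge : 32 * e ^+ 2 <= D * e ^+ 2.
Proof. by rewrite ler_wpM2r. Qed.

Lemma limit_prob0 : (`|P (Vinf @^-1` [set 0%R]) - (1 - (D / 2 + 1) * e)%:E|
  <= (8 * D ^+ 3 * e ^+ 2)%:E)%E.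
Proof.
apply: abse_sub_le; apply: (limit_prob_bounds d_gt0 iidX VinfP) => // n.
have -> : 0 = 2 * 0%:~R :> R by rewrite mulr0.
rewrite freq_point// mulr0 add0r.
have [_ a2] := round_tail_invariant R d32 n.
have [a1 _] := round_tail_invariant R d32 n.
have := round_tail2_lower R d32 n; have := round_tail0_lower R d32 n.
have := round_tail2_step d32 a1; have := round_tail0_step d32 a2.
have := D2e2_le; have := e2_le; have := De2_ge; have := e2_ge0.
rewrite -!mulrA.
move=> *; apply/andP; split; lra.
Qed.

(** The mass after [n] rounds is [(1 - a n 0) - (1 - a n (-2))], whose second term is at most
    [2 * e ^+ 2]. *)
Lemma limit_probN2 : (`|P (Vinf @^-1` [set (-2)%R]) - e%:E|
  <= (8 * D ^+ 3 * e ^+ 2)%:E)%E.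
Proof.
apply: abse_sub_le; apply: (limit_prob_bounds d_gt0 iidX VinfP) => // n.
have -> : -2 = 2 * (-1)%:~R :> R by rewrite mulrN1.
rewrite freq_point// mulrN1 addNr.
have [_ a2] := round_tail_invariant R d32 n.
have := round_tail_left R d32 n.+1 1; rewrite mulr1 expr1 => aN2.
have aN2' : a n.+1 (-2) <= 1 by exact: conf_tail_le1.
have := round_tail0_lower R d32 n; have := round_tail0_step d32 a2.
have := D2e2_le; have := e2_le; have := De2_ge; have := e2_ge0.
move: aN2; rewrite -!mulrA -expr2.
move=> *; apply/andP; split; lra.
Qed.

Lemma limit_prob2 : (`|P (Vinf @^-1` [set 2%R]) - (D / 2 * e)%:E|
  <= (4 * D ^+ 3 * e ^+ 2)%:E)%E.
Proof.
apply: abse_sub_le; apply: (limit_prob_bounds d_gt0 iidX VinfP) => // n.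
have -> : 2 = 2 * 1%:~R :> R by rewrite mulr1.
rewrite freq_point// mulr1.
have [a1 _] := round_tail_invariant R d32 n.
have := round_tail_right R d32 n.+1 1; rewrite mulr1 expr1 => a4.
have a40 : 0 <= a n.+1 (2 + 2) by exact: conf_tail_ge0.
have := round_tail2_lower R d32 n; have := round_tail2_step d32 a1.
have := D2e2_le; have := e2_le; have := De2_ge; have := e2_ge0.
move: a4; rewrite -!mulrA -expr2.
move=> *; apply/andP; split; lra.
Qed.

Lemma limit_prob_outside (j : nat) :
  (P (Vinf @^-1` @outside R j) <= ((D + 2) * e * e ^+ j)%:E)%E.
Proof.
suff /andP[] : (0%:E <= P (Vinf @^-1` @outside R j)
    <= ((D + 2) * e * e ^+ j)%:E)%E by [].
apply: (limit_prob_bounds d_gt0 iidX VinfP) => [|n].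
  exact: measurable_outside.
apply/andP; split; first by rewrite divr_ge0.
apply: le_trans (freq_outside _ _ _ _) _.
have := round_tail_left R d32 n.+1 j; have := round_tail_right R d32 n.+1 j.
lra.
Qed.

(** By [even_outside], an almost sure majorant of what values other than -2, 0 and 2 contribute to
    [Vinf]. *)
Definition far_part (w : T) : \bar R :=
  (\sum_(j <oo) (2 ^+ j.+2 * \1_(@outside R j.+1) (Vinf w) : R)%:E)%E.

Lemma measurable_far_term (j : nat) : measurable_fun setT
  (fun w => (2 ^+ j.+2 * \1_(@outside R j.+1) (Vinf w) : R)%:E).
Proof.
apply/measurable_EFinP; apply: measurable_funM => //.
by apply: measurableT_comp => //; apply: measurable_indic;
  exact: measurable_outside.
Qed.

Lemma integral_far_part : (\int[P]_w far_part w <= (8 * (D + 2) * e ^+ 2)%:E)%E.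
Proof.
have t0 j w : (0 <= (2 ^+ j.+2 * \1_(@outside R j.+1) (Vinf w) : R)%:E)%E.
  by rewrite lee_fin mulr_ge0.
rewrite integral_nneseries//; last by move=> j; exact: measurable_far_term.
have -> : 8 * (D + 2) * e ^+ 2 = 2 * (4 * (D + 2) * e ^+ 2) by ring.
apply: half_series_le => [|j]; first by rewrite !mulr_ge0// addr_ge0.
rewrite integral_ge0//=.
under eq_integral do rewrite EFinM.
rewrite ge0_integralZl//; last first.
  apply/measurable_EFinP; apply: measurableT_comp => //; apply: measurable_indic.
  exact: measurable_outside.
have -> : (\int[P]_w (\1_(@outside R j.+1) (Vinf w))%:E =
    P (Vinf @^-1` @outside R j.+1))%E.
  by apply: integral_indic_preimage; exact: measurable_outside.
apply: le_trans (lee_wpmul2l _ (limit_prob_outside _)) _ => //.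
rewrite -EFinM lee_fin.
(* The weights double from term to term while the tails decay by [e]; the ratio [2 * e] is at most
   1/2. *)
have -> : 2 ^+ j.+2 * ((D + 2) * e * e ^+ j.+1) =
    4 * (D + 2) * e ^+ 2 * (2 * e) ^+ j.
  by rewrite exprMn !exprS; ring.
rewrite ler_wpM2l ?mulr_ge0 ?addr_ge0//; apply: ler_expn.
  by rewrite mulr_ge0// ltW.
by have := e_le; lra.
Qed.

(** [Vinf] splits into [main], determined by the point masses at 2 and -2, and [far], of mean at
    most [8 * (D + 2) * e ^+ 2] in absolute value. The constant 32 covers [2 * (4 + 8)] from the
    point masses plus this remainder. *)
Lemma limit_expectation : (`|'E_P[Vinf] - ((D - 2) * e)%:E|
  <= (32 * D ^+ 3 * e ^+ 2)%:E)%E.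
Proof.
have mi (x : R) : measurable_fun setT (fun w => \1_[set x] (Vinf w) : R).
  by apply: measurableT_comp => //; exact: measurable_indic.
pose main w := 2 * (\1_[set 2] (Vinf w) - \1_[set -2] (Vinf w)) : R.
pose far w := Vinf w - main w.
have mfar : measurable_fun setT far.
  apply: measurable_funB => //; apply: measurable_funM => //.
  exact: measurable_funB.
have far_le : (\int[P]_w `|(far w)%:E| <= (8 * (D + 2) * e ^+ 2)%:E)%E.
  apply: le_trans integral_far_part.
  apply: ae_ge0_le_integral => //.
  - exact/measurable_EFinP/measurableT_comp.
  - move=> w _; apply: nneseries_ge0 => j _ _.
    by rewrite lee_fin mulr_ge0.
  - apply: ge0_emeasurable_sum => [j w _ _|j _].
      by rewrite lee_fin mulr_ge0.
    exact: measurable_far_term.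
  - apply: filterS (limit_attained d_gt0 iidX VinfP) => w [[z Vz] _] _.
    exact: (even_outside Vz).
have ifar : P.-integrable setT (EFin \o far).
  apply/integrableP; split; first exact/measurable_EFinP.
  by apply: le_lt_trans far_le _; rewrite ltry.
have ii (x : R) : P.-integrable setT (fun w => (\1_[set x] (Vinf w))%:E).
  apply: (@le_integrable _ _ _ P setT measurableT _ (cst 1%E)).
  - exact/measurable_EFinP.
  - by move=> w _ /=; rewrite lee_fin indicE normr1; case: (_ \in _);
      rewrite ?normr1 ?normr0.
  - exact: finite_measure_integrable_cst.
have EV : ('E_P[Vinf] = \int[P]_w (far w)%:E +
    2%:E * (P (Vinf @^-1` [set 2%R]) - P (Vinf @^-1` [set (-2)%R])))%E.
  rewrite -!integral_indic_preimage// -integralB// -integralZl//; last first.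
    exact: integrableB.
  rewrite -integralD//; last by apply: integrableZl => //; exact: integrableB.
  rewrite expectation_def; apply: eq_integral => w _.
  by rewrite -EFinB -EFinM -EFinD subrK.
have Ifin := integrable_fin_num measurableT ifar.
have fP (A : set R) : measurable A -> P (Vinf @^-1` A) \is a fin_num.
  move=> mA; apply: fin_num_measure.
  by rewrite -[X in measurable X]setTI; exact: measurable_funP.
have I_le := le_trans (le_abse_integral P measurableT
  (measurable_int P ifar)) far_le.
have := limit_prob2; have := limit_probN2; rewrite EV.
have := fP [set -2] (measurable_set1 _); have := fP [set 2] (measurable_set1 _).
move: Ifin I_le.
move: (\int[P]_w _)%E (P _) (P _) => [I||] // [q||] // [p||] // _ + _ _.
rewrite !lee_fin !ler_norml => /andP[I1 I2] /andP[p1 p2] /andP[q1 q2].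
have := e2_le; have := De2_ge; have := e2_ge0.
move: I1 I2 p1 p2 q1 q2; rewrite -!mulrA.
by move=> *; apply/andP; split; lra.
Qed.

End LimitAsymptotics.

Theorem theorem1p5 (R : realType) :
  exists (C : R) (d0 : nat), forall d : nat, (d0 <= d)%N ->
  forall (disp : measure_display) (T : measurableType disp)
    (P : probability T R) (X : edge d -> {RV P >-> R}) (Vinf : {RV P >-> R}),
  iid_cookies X ->
  {ae P, forall w, round_value X n w @[n --> \oo] --> Vinf w} ->
  let err := C * d%:R ^+ 3 * 2 ^- (2 * d) in
  [/\ (`| P (Vinf @^-1` [set 0%R])
          - (1 - (d%:R / 2 + 1) * 2 ^- d)%:E | <= err%:E)%E,
      (`| P (Vinf @^-1` [set (-2)%R]) - (2 ^- d)%:E | <= err%:E)%E,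
      (`| P (Vinf @^-1` [set 2%R]) - (d%:R / 2 * 2 ^- d)%:E | <= err%:E)%E
    & (`| 'E_P[Vinf] - ((d%:R - 2) * 2 ^- d)%:E | <= err%:E)%E ].
Proof.
(* The constant is the largest of the four estimates; the threshold is that of [8 * d ^ 4 <= 2 ^ d]
   in [expr4_le_expn2]. *)
exists 32, 32%N => d d32 disp T P X Vinf iidX VinfP err.
have errE : err = 32 * d%:R ^+ 3 * (2 ^- d) ^+ 2.
  by rewrite /err mulnC exprM exprVn.
have le_err (c : R) (y : \bar R) : c <= 32 ->
    (y <= (c * d%:R ^+ 3 * (2 ^- d) ^+ 2)%:E)%E -> (y <= err%:E)%E.
  move=> c32 /le_trans; apply; rewrite errE lee_fin.
  by rewrite !ler_wpM2r ?exprn_ge0// ?invr_ge0 ?exprn_ge0.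
split.
- by apply: le_err (limit_prob0 d32 iidX VinfP); rewrite ler_nat.
- by apply: le_err (limit_probN2 d32 iidX VinfP); rewrite ler_nat.
- by apply: le_err (limit_prob2 d32 iidX VinfP); rewrite ler_nat.
- by apply: le_err (limit_expectation d32 iidX VinfP).
Qed.
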